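(* Let $(\mathcal{M},g,\overset{1}{\nabla})$ be an $n$-dimensional ($n\ge 3$) GRW space-time with a semi-symmetric metric $P$-connection, $P$ unit timelike. For each $\alpha\in\{0,4\}$: $(\mathcal{M},g)$ is an Einstein manifold if and only if $\overset{\alpha}{\mathcal{R}}\cdot\overset{\alpha}{Ric}=0$.
   Context: Setting: $(\mathcal{M},g)$ is a Lorentzian manifold of signature $(-,+,\dots,+)$ with Levi-Civita connection $\overset{g}{\nabla}$; $P$ is a vector field with $g(P,P)=-1$, and $\pi(\cdot)=g(\cdot,P)$. The connection $\overset{1}{\nabla}_XY=\overset{g}{\nabla}_XY+\pi(Y)X-g(X,Y)P$ is a semi-symmetric metric $P$-connection, i.e. $\overset{1}{\nabla}P=0$; equivalently $\overset{g}{\nabla}_XP=X+\pi(X)P$ for all $X$. Such a manifold is a generalized Robertson-Walker (GRW) space-time (locally a warped product with metric $-(\mathrm dt)^2+f(t)^2g^*$, $g^*$ Riemannian). Associated connections: the mutual connection $\overset{2}{\nabla}_XY=\overset{1}{\nabla}_YX+[X,Y]$, that is $\overset{2}{\nabla}_XY=\overset{g}{\nabla}_XY+\pi(X)Y-g(X,Y)P$, and the symmetric connection $\overset{0}{\nabla}_XY=\frac12(\overset{1}{\nabla}_XY+\overset{2}{\nabla}_XY)$. Curvature tensors used: $\overset{0}{R}(X,Y)Z=\overset{0}{\nabla}_X\overset{0}{\nabla}_YZ-\overset{0}{\nabla}_Y\overset{0}{\nabla}_XZ-\overset{0}{\nabla}_{[X,Y]}Z$; $\overset{4}{R}(X,Y)Z=\overset{2}{\nabla}_X\overset{1}{\nabla}_YZ-\overset{1}{\nabla}_Y\overset{2}{\nabla}_XZ+\overset{2}{\nabla}_{\overset{2}{\nabla}_YX}Z-\overset{1}{\nabla}_{\overset{1}{\nabla}_XY}Z$.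 Ricci tensors: $\overset{\alpha}{Ric}(Y,Z)=\mathrm{tr}(X\mapsto\overset{\alpha}{R}(X,Y)Z)$, and likewise $\overset{g}{Ric}$ from the Levi-Civita curvature $\overset{g}{R}(X,Y)Z=\overset{g}{\nabla}_X\overset{g}{\nabla}_YZ-\overset{g}{\nabla}_Y\overset{g}{\nabla}_XZ-\overset{g}{\nabla}_{[X,Y]}Z$. The tensor $\overset{\alpha}{\mathcal{R}}\cdot\overset{\alpha}{Ric}$ is defined by $(\overset{\alpha}{\mathcal{R}}\cdot\overset{\alpha}{Ric})(U,V;X,Y)=-\overset{\alpha}{Ric}(\overset{\alpha}{R}(X,Y)U,V)-\overset{\alpha}{Ric}(U,\overset{\alpha}{R}(X,Y)V)$. Einstein manifold means (with respect to the Levi-Civita connection) $\overset{g}{Ric}=\lambda g$ with $\lambda$ constant. *)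

(* Defs.v *)
From HB Require Import structures.
From mathcomp Require Import all_boot all_order all_algebra.
From mathcomp Require Import all_classical all_reals all_analysis.

Set Implicit Arguments.
Unset Strict Implicit.
Unset Printing Implicit Defensive.

Import Order.TTheory GRing.Theory Num.Theory.
Import numFieldNormedType.Exports.

Local Open Scope classical_set_scope.
Local Open Scope ring_scope.

(* Only used for open [U], so that differentiability at the points of [U] does
   not depend on the values of [f] outside [U]. *)
Fixpoint Ck_on (R : realType) (n k : nat) (U : set 'rV[R]_n)
    (f : 'rV[R]_n -> R) : Prop :=
  if k is k'.+1 then
    (forall x, U x -> differentiable f x) /\
    (forall j : 'I_n, Ck_on k' U (fun x => 'D_(delta_mx 0 j) f x))
  else forall x, U x -> {for x, continuous f}.

Definition smooth_on (R : realType) (n : nat) (U : set 'rV[R]_n)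
    (f : 'rV[R]_n -> R) : Prop := forall k, Ck_on k U f.

(* A homeomorphism from the open set [chart_dom] onto the open set
   [chart_cod]; the values of the two maps outside these sets are junk. *)
Record chart (R : realType) (n : nat) (M : topologicalType) := Chart {
  chart_dom : set M;
  chart_cod : set 'rV[R]_n;
  chart_map : M -> 'rV[R]_n;
  chart_inv : 'rV[R]_n -> M;
  chart_dom_open : open chart_dom;
  chart_cod_open : open chart_cod;
  chart_map_cod : forall p, chart_dom p -> chart_cod (chart_map p);
  chart_inv_dom : forall x, chart_cod x -> chart_dom (chart_inv x);
  chart_mapK : forall p, chart_dom p -> chart_inv (chart_map p) = p;
  chart_invK : forall x, chart_cod x -> chart_map (chart_inv x) = x;
  chart_map_cont : forall p, chart_dom p -> {for p, continuous chart_map};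
  chart_inv_cont : forall x, chart_cod x -> {for x, continuous chart_inv}
}.

Record manifold (R : realType) (n : nat) := Manifold {
  pt :> topologicalType;
  atlas : set (chart R n pt);
  pt_hausdorff : hausdorff_space pt;
  pt_second_countable : @second_countable pt;
  atlas_cover : forall p : pt, exists2 c, atlas c & chart_dom c p;
  atlas_compat : forall c d, atlas c -> atlas d -> forall j : 'I_n,
    smooth_on (chart_cod c `&` chart_inv c @^-1` chart_dom d)
              (fun x => chart_map d (chart_inv c x) 0 j)
}.

Section CkClosure.
Context {R : realType} {n : nat}.
Implicit Types (U : set 'rV[R]_n) (f g : 'rV[R]_n -> R).

Lemma differentiable_near0 f x :
  (\forall y \near x, f y = 0) -> differentiable f x.
Proof.
move=> f0.
have fx0 : f x = 0 by exact: nbhs_singleton f0.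
have E : f \o shift x = cst (f x) + (0 : 'rV[R]_n -> R) +o_ 0 id.
  apply/eqaddoP => _/posnumP[e]; rewrite /= fx0.
  have : \forall h \near (0 : 'rV[R]_n), f (h + x) = 0.
    by have := f0; rewrite (near_shift 0) subr0.
  apply: filterS => h fh.
  rewrite -![(_ + _ : _ -> _) _]/(_ + _) -![(- _ : _ -> _) _]/(- _) /=.
  rewrite -![(_ + _ : _ -> _) _]/(_ + _) /= fh /cst addr0 subr0 normr0.
  by rewrite mulr_ge0.
apply/diff_locallyP.
have d0 : 'd f x = (\0 : {linear 'rV[R]_n -> R}) :> (_ -> _).
  by apply: diff_unique => //; exact: cst_continuous.
rewrite d0; split => //; exact: cst_continuous.
Qed.

Lemma near_eq_differentiable f g x :
  (\forall y \near x, f y = g y) -> differentiable f x -> differentiable g x.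
Proof.
move=> fg df.
have -> : g = f + (g - f) by rewrite addrC subrK.
apply: differentiableD => //; apply: differentiable_near0.
by apply: filterS fg => y fgy; rewrite /= !fctE fgy subrr.
Qed.

Lemma Ck_on_ext k U f g : open U ->
  (forall x, U x -> f x = g x) -> Ck_on k U f -> Ck_on k U g.
Proof.
move=> Uo; have nearU x : U x -> \forall y \near x, U y.
  by move=> Ux; exact: open_nbhs_nbhs.
elim: k f g => [|k IHk] f g fg /=.
  move=> fc x Ux; rewrite /prop_for /continuous_at -fg //.
  have fgx : {near x, f =1 g} by apply: filterS (nearU x Ux) => y /fg.
  exact: cvg_trans (near_eq_cvg fgx) (fc x Ux).
move=> [df Df]; split=> [x Ux|j].
  apply: near_eq_differentiable (df x Ux).
  by apply: filterS (nearU x Ux) => y /fg.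
apply: IHk (Df j) => x Ux; apply: near_eq_derive.
by apply: filterS (nearU x Ux) => y /fg.
Qed.

Lemma Ck_on_cst k U (a : R) : Ck_on k U (cst a).
Proof.
elim: k a => [|k IHk] a /=; first by move=> x _; exact: cst_continuous.
split=> [x _|j]; first exact: differentiable_cst.
have -> : (fun x : 'rV[R]_n => 'D_(delta_mx 0 j) (cst a) x) = cst (0 : R).
  by rewrite funeqE => x; rewrite derive_cst.
exact: IHk.
Qed.

Lemma Ck_onW k U f : Ck_on k.+1 U f -> Ck_on k U f.
Proof.
elim: k f => [|k IHk] f [df Df].
  by move=> x Ux; exact/differentiable_continuous/df.
by split=> // j; exact/IHk/Df.
Qed.

Lemma Ck_onD k U f g : open U ->
  Ck_on k U f -> Ck_on k U g -> Ck_on k U (f + g).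
Proof.
move=> Uo; elim: k f g => [|k IHk] f g.
  by move=> fc gc x Ux; apply: continuousD; [exact: fc|exact: gc].
move=> [df Df] [dg Dg]; split=> [x Ux|j].
  by apply: differentiableD; [exact: df|exact: dg].
apply: Ck_on_ext (IHk _ _ (Df j) (Dg j)) => // x Ux.
by rewrite deriveD //; apply/diff_derivable; [exact: df|exact: dg].
Qed.

Lemma Ck_onM k U f g : open U ->
  Ck_on k U f -> Ck_on k U g -> Ck_on k U (f * g).
Proof.
move=> Uo; elim: k f g => [|k IHk] f g.
  by move=> fc gc x Ux; apply: continuousM; [exact: fc|exact: gc].
move=> fk gk; have [df Df] := fk; have [dg Dg] := gk; split=> [x Ux|j].
  by apply: differentiableM; [exact: df|exact: dg].
have := Ck_onD Uo (IHk _ _ (Ck_onW fk) (Dg j)) (IHk _ _ (Ck_onW gk) (Df j)).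
apply: Ck_on_ext => // x Ux.
by rewrite deriveM //; apply/diff_derivable; [exact: df|exact: dg].
Qed.

End CkClosure.

Section SmoothFunctions.
Context {R : realType} {n : nat} (M : manifold R n).

Definition smooth (f : M -> R) : Prop :=
  forall c, atlas c -> smooth_on (chart_cod c) (f \o chart_inv c).

Definition smoothb (f : M -> R) : bool := `[< smooth f >].

Lemma smooth_cst (a : R) : smooth (cst a).
Proof. by move=> c _ k; exact: Ck_on_cst. Qed.

Lemma smoothD (f g : M -> R) : smooth f -> smooth g -> smooth (f + g).
Proof.
by move=> fs gs c Ac k; apply: Ck_onD (fs c Ac k) (gs c Ac k); exact: chart_cod_open.
Qed.

Lemma smoothM (f g : M -> R) : smooth f -> smooth g -> smooth (f * g).
Proof.
by move=> fs gs c Ac k; apply: Ck_onM (fs c Ac k) (gs c Ac k); exact: chart_cod_open.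
Qed.

Lemma smoothZ (a : R) (f : M -> R) : smooth f -> smooth (a *: f).
Proof. by move=> fs; exact: smoothM (smooth_cst a) fs. Qed.

Fact smooth_subring : subring_closed smoothb.
Proof.
split=> [|f g /asboolP fs /asboolP gs|f g /asboolP fs /asboolP gs];
  apply/asboolP.
- exact: smooth_cst.
- by rewrite -scaleN1r; exact/smoothD/smoothZ.
- exact: smoothM.
Qed.

Fact smooth_scale : GRing.scaler_closed smoothb.
Proof. by move=> a f /asboolP fs; apply/asboolP; exact: smoothZ. Qed.

HB.instance Definition _ :=
  GRing.isSubringClosed.Build (M -> R) smoothb smooth_subring.
HB.instance Definition _ :=
  GRing.isScaleClosed.Build R (M -> R) smoothb smooth_scale.

Record smooth_fun := SmoothFun {
  smooth_val :> M -> R; smooth_valP : smoothb smooth_val }.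

HB.instance Definition _ := [isSub of smooth_fun for smooth_val].
HB.instance Definition _ := [Choice of smooth_fun by <:].
HB.instance Definition _ := GRing.SubChoice_isSubComPzRing.Build
  (M -> R) smoothb smooth_fun smooth_subring.
HB.instance Definition _ := [SubZmodule_isSubLmodule of smooth_fun by <:].

Lemma smooth_funP (f g : smooth_fun) : f =1 g -> f = g.
Proof. by move=> fg; exact/val_inj/funext. Qed.

Lemma smooth_valD (f g : smooth_fun) p : (f + g) p = f p + g p.
Proof. by rewrite -[smooth_val]/val raddfD. Qed.

Lemma smooth_valM (f g : smooth_fun) p : (f * g) p = f p * g p.
Proof. by rewrite -[smooth_val]/val rmorphM. Qed.

Lemma smooth_valZ (a : R) (f : smooth_fun) p : (a *: f) p = a * f p.
Proof. by rewrite -[smooth_val]/val linearZ. Qed.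

Lemma smooth_scalerAl (a : R) (f g : smooth_fun) : a *: (f * g) = (a *: f) * g.
Proof.
by apply: smooth_funP => p; rewrite !(smooth_valZ, smooth_valM) mulrA.
Qed.

Lemma smooth_scalerAr (a : R) (f g : smooth_fun) : a *: (f * g) = f * (a *: g).
Proof. by rewrite mulrC smooth_scalerAl mulrC. Qed.

End SmoothFunctions.

Section VectorFields.
Context {R : realType} {n : nat} (M : manifold R n).

Definition derivation (D : smooth_fun M -> (smooth_fun M)^o) : Prop :=
  (forall (a : R) f g, D (a *: f + g) = a *: (D f : smooth_fun M) + D g) /\
  (forall f g, D (f * g) = D f * g + f * D g).

Definition derivationb (D : smooth_fun M -> (smooth_fun M)^o) : bool :=
  `[< derivation D >].

Fact derivation_submod : GRing.submod_closed derivationb.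
Proof.
have sE (h f : smooth_fun M) : h *: (f : (smooth_fun M)^o) = h * f by [].
split=> [|h D E /asboolP[Dl DM] /asboolP[El EM]]; apply/asboolP.
  split=> [a f g|f g]; rewrite /= ?fctE; first by rewrite scaler0 addr0.
  by rewrite mul0r mulr0 addr0.
split=> [a f g|f g]; rewrite !fctE /= !sE.
  by rewrite Dl El mulrDr -smooth_scalerAr scalerDr addrACA.
rewrite DM EM !(mulrDl, mulrDr) addrACA; congr (_ + _ + (_ + _)).
  by rewrite mulrA.
by rewrite mulrCA.
Qed.

HB.instance Definition _ := GRing.isSubmodClosed.Build (smooth_fun M)
  (smooth_fun M -> (smooth_fun M)^o) derivationb
  (GRing.submod_closed_semi derivation_submod).

(* Smooth vector fields, identified with the derivations of C^oo(M). *)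
Record vfield := VField {
  vfield_fun :> smooth_fun M -> (smooth_fun M)^o;
  vfield_funP : derivationb vfield_fun }.

HB.instance Definition _ := [isSub of vfield for vfield_fun].
HB.instance Definition _ := [Choice of vfield by <:].
HB.instance Definition _ := [SubChoice_isSubLmodule of vfield by <:].

Fact lie_subproof (X Y : vfield) :
  derivationb (fun f => X (Y f) - Y (X f)).
Proof.
move: (vfield_funP X) (vfield_funP Y) => /asboolP[Xl XM] /asboolP[Yl YM].
have XD f g : X (f + g) = X f + X g by rewrite -[f]scale1r Xl !scale1r.
have YD f g : Y (f + g) = Y f + Y g by rewrite -[f]scale1r Yl !scale1r.
apply/asboolP; split=> [a f g|f g].
  by rewrite Yl !Xl Yl scalerBr opprD addrACA.
rewrite XM YM XD YD !XM !YM mulrBl mulrBr.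
have rearrange (x y z w u v : smooth_fun M) :
    x + y + (z + w) - (u + z + (y + v)) = x - u + (w - v).
  rewrite [u + z + _]addrACA !opprD addrACA [x + y + _]addrACA.
  by rewrite [z + w + _]addrACA !subrr addr0 add0r.
exact: rearrange.
Qed.

Definition lie (X Y : vfield) : vfield := VField (lie_subproof X Y).

End VectorFields.

Section TangentSpaces.
Context {R : realType} {n : nat} (M : manifold R n) (p : M).

Definition derivation_at (v : smooth_fun M -> R^o) : Prop :=
  (forall (a : R) f g, v (a *: f + g) = a * v f + v g) /\
  (forall f g, v (f * g) = v f * g p + f p * v g).

Definition derivation_atb (v : smooth_fun M -> R^o) : bool :=
  `[< derivation_at v >].

Fact derivation_at_submod : GRing.submod_closed derivation_atb.
Proof.
have sE (a x : R) : a *: (x : R^o) = a * x by [].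
split=> [|a u v /asboolP[ul uM] /asboolP[vl vM]]; apply/asboolP.
  split=> [a f g|f g]; rewrite /= ?fctE; first by rewrite mulr0 addr0.
  by rewrite mul0r mulr0 addr0.
split=> [b f g|f g]; rewrite !fctE /= !sE.
  by rewrite ul vl !mulrDr addrACA mulrCA.
rewrite uM vM !(mulrDl, mulrDr) addrACA; congr (_ + _ + (_ + _)).
  by rewrite mulrA.
by rewrite mulrCA.
Qed.

HB.instance Definition _ := GRing.isSubmodClosed.Build R
  (smooth_fun M -> R^o) derivation_atb
  (GRing.submod_closed_semi derivation_at_submod).

(* T_pM, as the space of derivations at p of the algebra of globally defined
   smooth functions; bump functions make it the same as that of germs. *)
Record tangent := Tangent {
  tangent_fun :> smooth_fun M -> R^o;
  tangent_funP : derivation_atb tangent_fun }.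

HB.instance Definition _ := [isSub of tangent for tangent_fun].
HB.instance Definition _ := [Choice of tangent by <:].
HB.instance Definition _ := [SubChoice_isSubLmodule of tangent by <:].

Fact value_subproof (X : vfield M) :
  derivation_atb (fun f => (X f : smooth_fun M) p).
Proof.
move: (vfield_funP X) => /asboolP[Xl XM].
by apply/asboolP; split=> [a f g|f g]; rewrite ?Xl ?XM.
Qed.

Definition value (X : vfield M) : tangent := Tangent (value_subproof X).

(* The values at p of the fields E_i form a basis of T_pM. *)
Definition frame_at (E : 'I_n -> vfield M) : Prop :=
  forall v : tangent, exists! c : 'rV[R]_n, v = \sum_i c 0 i *: value (E i).

(* The trace of the endomorphism of T_pM induced by a C^oo(M)-linear map [A],
   i.e. of the endomorphism sending the value of X to the value of A X. *)
Definition trace_at (A : vfield M -> vfield M) : R :=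
  get [set t | exists (E : 'I_n -> vfield M) (a : 'M[R]_n),
    [/\ frame_at E,
        forall i, value (A (E i)) = \sum_j a i j *: value (E j)
      & t = \tr a]].

End TangentSpaces.

(* Every basis of T_pM extends to global vector fields, so the signature can be
   read off frames made of such fields. *)
Record lorentz_metric (R : realType) (n : nat) (M : manifold R n) :=
  LorentzMetric {
  metric_at : forall p : M, tangent p -> tangent p -> R;
  metric_sym : forall p (u v : tangent p), metric_at u v = metric_at v u;
  metric_linear : forall p (a : R) (u v w : tangent p),
    metric_at (a *: u + v) w = a * metric_at u w + metric_at v w;
  metric_smooth : forall X Y : vfield M,
    smooth (fun p => metric_at (value p X) (value p Y));
  metric_signature : forall p, exists2 E : 'I_n -> vfield M, frame_at p E &
    forall i j, metric_at (value p (E i)) (value p (E j)) =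
      if i == j then (if i == 0%N :> nat then -1 else 1) else 0
}.

Definition metric (R : realType) (n : nat) (M : manifold R n)
    (g : lorentz_metric M) (X Y : vfield M) : smooth_fun M :=
  SmoothFun (asboolT (metric_smooth g X Y)).

Section Geometry.
Context {R : realType} {n : nat} {M : manifold R n}.
Local Notation C := (smooth_fun M).
Local Notation VF := (vfield M).

Definition connection (D : VF -> VF -> VF) : Prop :=
  [/\ forall (f : C) X Y Z, D (f *: X + Y) Z = f *: D X Z + D Y Z,
      forall X Y Z, D X (Y + Z) = D X Y + D X Z
    & forall (f : C) X Y, D X (f *: Y) = (X f : C) *: Y + f *: D X Y].

Definition levi_civita (g : lorentz_metric M) (D : VF -> VF -> VF) : Prop :=
  [/\ connection D,
      forall X Y, D X Y - D Y X = lie X Y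
    & forall X Y Z : VF,
        X (metric g Y Z) = metric g (D X Y) Z + metric g Y (D X Z)].

(* With [Dg] the Levi-Civita connection of [g]: [conn1] is the semi-symmetric
   metric connection with generator P, [conn2] its mutual connection (opposite
   torsion) and [conn0] their average, which is torsion-free. *)
Section Connections.
Variables (g : lorentz_metric M) (Dg : VF -> VF -> VF) (P : VF).

Definition one_form (X : VF) : C := metric g X P.

Definition conn1 (X Y : VF) : VF := Dg X Y + one_form Y *: X - metric g X Y *: P.

Definition conn2 (X Y : VF) : VF := conn1 Y X + lie X Y.

Definition conn0 (X Y : VF) : VF :=
  ((2^-1 : R) *: (1 : C)) *: (conn1 X Y + conn2 X Y).

End Connections.

Definition curvature (D : VF -> VF -> VF) (X Y Z : VF) : VF :=
  D X (D Y Z) - D Y (D X Z) - D (lie X Y) Z.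

Definition curvature4 (D1 D2 : VF -> VF -> VF) (X Y Z : VF) : VF :=
  D2 X (D1 Y Z) - D1 Y (D2 X Z) + D2 (D2 Y X) Z - D1 (D1 X Y) Z.

Definition ricci (Rm : VF -> VF -> VF -> VF) (Y Z : VF) (p : M) : R :=
  trace_at p (fun X => Rm X Y Z).

(* The tensor (Rm . Ric)(U, V; X, Y), Rm(X, Y) acting on Ric as a derivation. *)
Definition curv_ricci (Rm : VF -> VF -> VF -> VF) (U V X Y : VF) (p : M) : R :=
  - ricci Rm (Rm X Y U) V p - ricci Rm U (Rm X Y V) p.

Definition einstein (g : lorentz_metric M) (Dg : VF -> VF -> VF) : Prop :=
  exists lambda : R, forall Y Z p,
    ricci (curvature Dg) Y Z p = lambda * metric g Y Z p.

End Geometry.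

(* Main.v *)
From HB Require Import structures.
Require Import Defs.
From mathcomp Require Import all_boot all_order all_algebra.
From mathcomp Require Import all_classical all_reals all_analysis.
From mathcomp Require Import ring.

Set Implicit Arguments.
Unset Strict Implicit.
Unset Printing Implicit Defensive.

Import GRing.Theory Num.Theory.
Local Open Scope ring_scope.

(** Write [pi X = g(X, P)] and [B(X, Y) = pi(X) Y - pi(Y) X].  The connection
    D1 = [conn1] is metric and makes P parallel, hence it makes g, pi, B and
    every tensor built from them parallel; its torsion is - B.  The other
    connections are D1 plus such parallel tensors: D0 = D1 + B/2, D2 = D1 + B,
    and the Levi-Civita connection is D1 + (g(X, Y) P - pi(Y) X).  Adding a
    parallel tensor A changes the curvature only by terms algebraic in A and
    the torsion ([curvature_parallel_shift]).  With R1 the curvature of D1: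
      - R1(X, Y) Z = Rg(X, Y) Z - g(Y, Z) X + g(X, Z) Y;
      - R0(X, Y) Z = R1(X, Y) Z + k pi(Z) B(X, Y) with k = 1/4, and R4 is the
        same with k = 1 ([curvature4_wedge]).

    Taking traces, Ric1 = Ric - (n - 1) g, and R1(X, Y) P = 0 gives
    Ric1(U, P) = 0.  So g is Einstein if and only if Ric1 = 0: evaluating
    Ric = lambda g on (P, P) forces lambda = n - 1 ([einstein_ricci1]).

    Both curvatures being of the form
    Rk(X, Y) Z = R1(X, Y) Z + k pi(Z) B(X, Y) with k nowhere zero,
    it remains to show that Ric1 = 0 if and only if Rk . Ric_k = 0
    ([curv_ricci_shift]).  Here Ric_k = Ric1 - k (n - 1) pi pi, and Rk(X, Y) Z
    is always orthogonal to P.  If Ric1 = 0, then Ric_k is a multiple of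
    pi pi, which vanishes on the values of Rk.  Conversely,
    (Rk . Ric_k)(U, P; P, Y) involves Rk(P, Y) P = k (Y + pi(Y) P) and reduces
    to - k Ric1(U, Y).

    The trace of a C^oo-linear map A on vector fields is computed pointwise
    as the sum of e_i g(A E_i, E_i), for a frame E orthonormal at the point, with
    e_i = g(E_i, E_i) its signs ([trace_atE]).  For this to make sense,
    the value of A X at p must only depend on the value of X at p.  Instead of
    bump functions, the proof uses Cramer's rule: if d is the determinant of the
    Gram matrix of fields E_i, then d^2 X is a global combination of the E_i, with coefficients that
    vanish wherever X does ([cramer_expansion]). *)

(** * Pointwise evaluation of functions and vector fields *)

Section Pointwise.
Context {R : realType} {n : nat} {M : manifold R n}.
Implicit Types (p : M) (f : smooth_fun M) (X Y Z : vfield M).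

(** Evaluation is packaged as a ring morphism so that it commutes with
    determinants of matrices of smooth functions. *)
Definition eval p f : R := f p.

Fact eval_zmod p : zmod_morphism (eval p).
Proof. by move=> f f'; rewrite /eval -[@smooth_val _ _ M]/val raddfB. Qed.
Fact eval_monoid p : monoid_morphism (eval p).
Proof.
by split=> [|f f']; rewrite /eval -[@smooth_val _ _ M]/val ?rmorph1 ?rmorphM.
Qed.
HB.instance Definition _ p :=
  GRing.isZmodMorphism.Build (smooth_fun M) R (eval p) (eval_zmod p).
HB.instance Definition _ p :=
  GRing.isMonoidMorphism.Build (smooth_fun M) R (eval p) (eval_monoid p).

Lemma smooth_val1 p : (1 : smooth_fun M) p = 1.
Proof. exact: (rmorph1 (eval p)). Qed.
Lemma smooth_val0 p : (0 : smooth_fun M) p = 0.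
Proof. exact: (raddf0 (eval p)). Qed.
Lemma smooth_valN f p : (- f) p = - f p.
Proof. exact: (raddfN (eval p)). Qed.

Lemma tangent_ext p (u v : tangent p) : tangent_fun u =1 tangent_fun v -> u = v.
Proof. by move=> uv; exact/val_inj/funext. Qed.

Lemma vfield_ext X Y : (forall p, value p X = value p Y) -> X = Y.
Proof.
move=> XY; apply: val_inj; apply: funext => f; apply: smooth_funP => p.
by have /(congr1 (fun v : tangent p => tangent_fun v f)) := XY p.
Qed.

Lemma valueD p X Y : value p (X + Y) = value p X + value p Y.
Proof. by apply: tangent_ext => h; exact: (smooth_valD (X h) (Y h) p). Qed.

Lemma valueZ p f X : value p (f *: X) = f p *: value p X.
Proof. by apply: tangent_ext => h; exact: (smooth_valM f (X h) p). Qed.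

Lemma value0 p : value p (0 : vfield M) = 0.
Proof. by rewrite -[0 in LHS](scale0r 0) valueZ smooth_val0 scale0r. Qed.

Lemma valueN p X : value p (- X) = - value p X.
Proof. by rewrite -scaleN1r valueZ smooth_valN smooth_val1 scaleN1r. Qed.

Lemma value_sum p (I : finType) (F : I -> vfield M) :
  value p (\sum_i F i) = \sum_i value p (F i).
Proof. exact: (big_morph _ (valueD p) (value0 p)). Qed.

End Pointwise.

(** * Bilinearity of the metric *)

Section MetricAlgebra.
Context {R : realType} {n : nat} {M : manifold R n} (g : lorentz_metric M).
Implicit Types (p : M) (f : smooth_fun M) (X Y Z : vfield M).

Section AtPoint.
Context {p : M}.
Implicit Types u v w : tangent p.

Lemma metric_at0l w : metric_at g (0 : tangent p) w = 0.
Proof.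
by have := metric_linear g (-1) 0 0 w; rewrite scaler0 addr0 mulN1r addNr.
Qed.
Lemma metric_atDl u v w : metric_at g (u + v) w = metric_at g u w + metric_at g v w.
Proof. by have := metric_linear g 1 u v w; rewrite scale1r mul1r. Qed.
Lemma metric_atZl a u w : metric_at g (a *: u) w = a * metric_at g u w.
Proof. by have := metric_linear g a u 0 w; rewrite metric_at0l !addr0. Qed.
Lemma metric_at_suml (I : finType) (u : I -> tangent p) w :
  metric_at g (\sum_i u i) w = \sum_i metric_at g (u i) w.
Proof.
exact: (big_morph (fun u : tangent p => metric_at g u w)
  (fun u v => metric_atDl u v w) (metric_at0l w)).
Qed.

End AtPoint.

Lemma metricE X Y p : metric g X Y p = metric_at g (value p X) (value p Y).
Proof. by []. Qed.

Lemma metricC X Y : metric g X Y = metric g Y X.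
Proof. by apply: smooth_funP => p; rewrite !metricE Defs.metric_sym. Qed.

Lemma metricDl X Y Z : metric g (X + Y) Z = metric g X Z + metric g Y Z.
Proof.
by apply: smooth_funP => p; rewrite smooth_valD !metricE valueD metric_atDl.
Qed.
Lemma metricZl f X Z : metric g (f *: X) Z = f * metric g X Z.
Proof.
by apply: smooth_funP => p; rewrite smooth_valM !metricE valueZ metric_atZl.
Qed.
Lemma metricNl X Z : metric g (- X) Z = - metric g X Z.
Proof. by rewrite -scaleN1r metricZl mulN1r. Qed.
Lemma metric0l Z : metric g 0 Z = 0.
Proof. by rewrite -[0 in LHS](scale0r 0) metricZl mul0r. Qed.
Lemma metric0r Z : metric g Z 0 = 0.
Proof. by rewrite metricC metric0l. Qed.
Lemma metricDr X Y Z : metric g Z (X + Y) = metric g Z X + metric g Z Y.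
Proof. by rewrite !(metricC Z) metricDl. Qed.
Lemma metricZr f X Z : metric g Z (f *: X) = f * metric g Z X.
Proof. by rewrite !(metricC Z) metricZl. Qed.
Lemma metricNr X Z : metric g Z (- X) = - metric g Z X.
Proof. by rewrite !(metricC Z) metricNl. Qed.

End MetricAlgebra.

(** * Traces of C^oo-linear maps *)

Section Trace.
Context {R : realType} {n : nat} {M : manifold R n} (g : lorentz_metric M).
Implicit Types (p q : M) (f : smooth_fun M) (X Y Z : vfield M).

Definition lsign (i : 'I_n) : R := if i == 0%N :> nat then -1 else 1.

Definition orthonormal_at p (E : 'I_n -> vfield M) : Prop :=
  forall i j, metric g (E i) (E j) p = if i == j then lsign i else 0.

Lemma lsign_sqr i : lsign i * lsign i = 1.
Proof. by rewrite /lsign; case: ifP; rewrite ?mulrNN mulr1. Qed.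

Lemma orthonormal_expansion p (E : 'I_n -> vfield M) (v : tangent p) :
  frame_at p E -> orthonormal_at p E ->
  v = \sum_i (lsign i * metric_at g v (value p (E i))) *: value p (E i).
Proof.
move=> frE onE; have [c [vE _]] := frE v; rewrite [LHS]vE.
apply: eq_bigr => j _; congr (_ *: _).
rewrite vE metric_at_suml (bigD1 j) //= metric_atZl -metricE onE eqxx big1 ?addr0.
  by rewrite mulrCA lsign_sqr mulr1.
by move=> i /negPf ij; rewrite metric_atZl -metricE onE ij mulr0.
Qed.

Definition gram (E : 'I_n -> vfield M) : 'M[smooth_fun M]_n :=
  \matrix_(i, j) metric g (E i) (E j).

Lemma gram_det_orthonormal p E : orthonormal_at p E -> (\det (gram E)) p != 0.
Proof.
move=> onE; rewrite -[_ p]/(eval p _) -det_map_mx.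
have -> : map_mx (eval p) (gram E) = diag_mx (\row_i lsign i).
  apply/matrixP => i j; rewrite !mxE /eval onE.
  by case: eqP => [->|_]; rewrite ?mulr1n ?mulr0n.
rewrite det_diag; apply/prodf_neq0 => i _; rewrite mxE.
apply/eqP => s0; have := lsign_sqr i; rewrite s0 mul0r => /eqP.
by rewrite eq_sym oner_eq0.
Qed.

(** The orthonormal frame at q provided by the signature shows that T_qM has
    dimension n, so n fields with invertible Gram matrix already span it. *)
Lemma gram_nondegenerate q E (v : tangent q) : (\det (gram E)) q != 0 ->
  (forall j, metric_at g v (value q (E j)) = 0) -> v = 0.
Proof.
move=> dE vE; have [F frF onF'] := metric_signature g q.
have onF : orthonormal_at q F by [].
have expF w := orthonormal_expansion w frF onF.
pose m : 'M[R]_n := \matrix_(i, k) metric g (E i) (F k) q.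
pose s : 'M[R]_n := diag_mx (\row_i lsign i).
have gramE : map_mx (eval q) (gram E) = m *m s *m m^T.
  apply/matrixP => i j; rewrite !mxE /eval metricE.
  rewrite (expF (value q (E i))) metric_at_suml; apply: eq_bigr => k _.
  rewrite mul_mx_diag !mxE metric_atZl [lsign k * _]mulrC.
  by rewrite (Defs.metric_sym g (value q (F k))).
have mu : m \in unitmx.
  have : m *m s *m m^T \in unitmx by rewrite -gramE unitmxE unitfE det_map_mx.
  by rewrite !unitmx_mul => /andP[/andP[]].
pose a : 'cV[R]_n := \col_k (lsign k * metric_at g v (value q (F k))).
have ma0 : m *m a = 0.
  apply/matrixP => i j; rewrite mxE mxE -[RHS](vE i) {1}(expF v) metric_at_suml.
  apply: eq_bigr => k _.
  by rewrite !mxE metric_atZl mulrC (Defs.metric_sym g (value q (F k))).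
have a0 : a = 0 by rewrite -[a]mul1mx -(mulVmx mu) -mulmxA ma0 mulmx0.
rewrite (expF v) big1 // => k _.
by have /matrixP/(_ k 0) := a0; rewrite !mxE => ->; rewrite scale0r.
Qed.

(** Cramer's rule gives [d *: X] as a combination of the fields [E i] where [d]
    does not vanish; the second factor [d] makes both sides vanish elsewhere, so
    that the identity holds on the whole manifold. *)
Lemma cramer_expansion E X : let d := \det (gram E) in
  d *: (d *: X) =
  \sum_i (d * (\sum_j metric g X (E j) * (\adj (gram E)) j i)) *: E i.
Proof.
move=> d; apply: vfield_ext => q.
rewrite valueZ value_sum.
have [d0|dn0] := eqVneq (d q) 0.
  rewrite d0 scale0r big1 // => i _.
  by rewrite valueZ smooth_valM d0 mul0r scale0r.
pose c i : smooth_fun M := \sum_j metric g X (E j) * (\adj (gram E)) j i.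
under eq_bigr => i _ do rewrite -/(c i) -scalerA valueZ.
rewrite -scaler_sumr; congr (_ *: _).
apply/eqP; rewrite -value_sum -subr_eq0 -valueN -valueD; apply/eqP.
apply: (gram_nondegenerate dn0) => j.
rewrite -metricE -[RHS](smooth_val0 q); congr (smooth_val _ q).
rewrite metricDl metricZl metricNl; apply/eqP; rewrite subr_eq0; apply/eqP.
have -> : metric g (\sum_i c i *: E i) (E j) = \sum_i c i * gram E i j.
  rewrite (big_morph (fun W => metric g W (E j)) (id1 := 0) (op1 := +%R)).
  - by apply: eq_bigr => i _; rewrite metricZl mxE.
  - by move=> U V; rewrite metricDl.
  - by rewrite -[X in metric _ X](scale0r 0) metricZl mul0r.
pose r : 'rV_n := \row_k metric g X (E k).
have /matrixP/(_ 0 j) : r *m \adj (gram E) *m gram E = d *: r.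
  by rewrite -mulmxA mul_adj_mx mul_mx_scalar.
rewrite !mxE => <-; apply: eq_bigr => i _; congr (_ * _); rewrite mxE.
by apply: eq_bigr => k _; rewrite mxE.
Qed.

Section Tensorial.
Variables (A : vfield M -> vfield M) (linA : linear A).

Let L : {linear vfield M -> vfield M} :=
  HB.pack A (GRing.isLinear.Build _ _ _ _ A linA).

(** A vector field vanishing at p is, up to the factor [d ^ 2] with [d p] nonzero,
    a combination of global fields with coefficients vanishing at p. *)
Lemma tensorial_value0 p X : value p X = 0 -> value p (A X) = 0.
Proof.
move=> X0; have [E _ onE'] := metric_signature g p.
have onE : orthonormal_at p E by [].
have dn0 := gram_det_orthonormal onE; set d := \det (gram E) in dn0.
have : value p (L (d *: (d *: X))) = 0.
  rewrite cramer_expansion linear_sum value_sum big1 // => i _.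
  rewrite linearZ valueZ smooth_valM -[X in _ * X]/(eval p _) raddf_sum big1.
    by rewrite mulr0 scale0r.
  move=> j _; rewrite -[LHS]/(smooth_val (_ * _) p) smooth_valM.
    by rewrite metricE X0 metric_at0l mul0r.
rewrite !linearZ !valueZ => /eqP; rewrite !scaler_eq0 (negPf dn0) /=.
by move=> /eqP.
Qed.

Lemma tensorial_value p (m : nat) (X : vfield M) (c : 'I_m -> R)
    (F : 'I_m -> vfield M) :
  value p X = \sum_i c i *: value p (F i) ->
  value p (A X) = \sum_i c i *: value p (A (F i)).
Proof.
pose k (a : R) : smooth_fun M := a *: (1 : smooth_fun M).
have kE a : (k a) p = a by rewrite smooth_valZ smooth_val1 mulr1.
move=> XF; apply/eqP; rewrite -subr_eq0; apply/eqP.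
have <- : value p (L (X - \sum_i k (c i) *: F i)) =
    value p (A X) - \sum_i c i *: value p (A (F i)).
  rewrite linearB valueD valueN linear_sum value_sum; congr (_ - _).
  by apply: eq_bigr => i _; rewrite linearZ valueZ kE.
apply: tensorial_value0; rewrite valueD valueN value_sum XF.
apply/eqP; rewrite subr_eq0; apply/eqP; apply: eq_bigr => i _.
by rewrite valueZ kE.
Qed.

(** The right-hand side does not mention the frame F and the matrix a from which
    the trace is read off, so all choices of F give the same number. *)
Lemma trace_atE p E : frame_at p E -> orthonormal_at p E ->
  trace_at p A = \sum_i lsign i * metric g (A (E i)) (E i) p.
Proof.
move=> frE onE; have expE v := orthonormal_expansion v frE onE.
rewrite /trace_at; set S := (T in get T).
have S_uniq t : S t -> t = \sum_i lsign i * metric g (A (E i)) (E i) p.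
  (* b and c are the changes of basis between F and E. *)
  move=> [F [a [frF AF ->]]].
  pose b : 'M[R]_n := \matrix_(i, k) (lsign k * metric g (F i) (E k) p).
  have bE i : value p (F i) = \sum_k b i k *: value p (E k).
    by rewrite [LHS]expE; apply: eq_bigr => k _; rewrite mxE.
  have [c cF] : exists c : 'M[R]_n,
      forall k, value p (E k) = \sum_i c k i *: value p (F i).
    have /choice[c cP] : forall k, exists r : 'rV[R]_n,
        value p (E k) = \sum_i r 0 i *: value p (F i).
      by move=> k; have [r [rE _]] := frF (value p (E k)); exists r.
    exists (\matrix_(k, i) c k 0 i) => k; rewrite {1}cP.
    by apply: eq_bigr => i _; rewrite mxE.
  have combM (x y : 'M[R]_n) (u v w : 'I_n -> tangent p) :
      (forall i, u i = \sum_j x i j *: v j) ->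
      (forall i, v i = \sum_j y i j *: w j) ->
      forall i, u i = \sum_j (x *m y) i j *: w j.
    move=> ux vy i; rewrite ux; under eq_bigr => j _ do rewrite vy scaler_sumr.
    rewrite exchange_big; apply: eq_bigr => l _ /=; rewrite mxE scaler_suml.
    by apply: eq_bigr => j _; rewrite scalerA.
  have bc1 : b *m c = 1%:M.
    have FF := combM _ _ _ _ _ bE cF.
    apply/row_matrixP => i; have [r [_ r_uniq]] := frF (value p (F i)).
    transitivity r; [apply/esym|]; apply: r_uniq.
      by rewrite FF; apply: eq_bigr => j _; rewrite [in RHS]mxE.
    rewrite (bigD1 i) //= row1 mxE !eqxx scale1r big1 ?addr0 // => j ji.
    by rewrite mxE (negPf ji) andbF scale0r.
  have AE k := tensorial_value (cF k).
  have AEE := combM _ _ _ _ _ (combM _ _ _ _ _ AE AF) bE.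
  rewrite -[a]mulmx1 -bc1 mulmxA mxtrace_mulC mulmxA; apply: eq_bigr => k _.
  rewrite metricE AEE metric_at_suml (bigD1 k) //= metric_atZl -metricE onE eqxx.
  rewrite big1 ?addr0; first by rewrite mulrCA lsign_sqr mulr1.
  by move=> j /negPf jk; rewrite metric_atZl -metricE onE jk mulr0.
apply: S_uniq; apply: getI.
exists E, (\matrix_(i, j) (lsign j * metric g (A (E i)) (E j) p)); split=> // i.
by rewrite [LHS]expE; apply: eq_bigr => j _; rewrite mxE.
Qed.

End Tensorial.
End Trace.

Section TraceRules.
Context {R : realType} {n : nat} {M : manifold R n} (g : lorentz_metric M).
Implicit Types (p : M) (f : smooth_fun M) (X Y Z : vfield M).
Implicit Types A B : vfield M -> vfield M.

Lemma trace_atD p A B : linear A -> linear B ->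
  trace_at p (fun X => A X + B X) = trace_at p A + trace_at p B.
Proof.
move=> lA lB; have [E frE onE] := metric_signature g p.
have lAB : linear (fun X => A X + B X).
  by move=> f X Y; rewrite lA lB scalerDr addrACA.
rewrite (trace_atE (g := g) lA frE) // (trace_atE (g := g) lB frE) //.
rewrite (trace_atE (g := g) lAB frE) // -big_split /=; apply: eq_bigr => i _.
by rewrite valueD metric_atDl mulrDr.
Qed.

Lemma trace_atZ p f A : linear A ->
  trace_at p (fun X => f *: A X) = f p * trace_at p A.
Proof.
move=> lA; have [E frE onE] := metric_signature g p.
have lfA : linear (fun X => f *: A X).
  by move=> h X Y; rewrite lA scalerDr !scalerA [f * h]mulrC.
rewrite (trace_atE (g := g) lA frE) // (trace_atE (g := g) lfA frE) //.
rewrite mulr_sumr; apply: eq_bigr => i _.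
by rewrite metricZl smooth_valM mulrCA.
Qed.

Lemma trace_at_id p : trace_at p (fun X : vfield M => X) = n%:R.
Proof.
have [E frE onE] := metric_signature g p.
have lid : linear (fun X : vfield M => X) by [].
rewrite (trace_atE (g := g) lid frE) // -[in RHS](card_ord n) -sum1_card natr_sum.
apply: eq_bigr => i _; rewrite metricE onE eqxx.
exact: lsign_sqr.
Qed.

Lemma trace_at_rank1 p Y Z :
  trace_at p (fun X => metric g X Z *: Y) = metric g Y Z p.
Proof.
have [E frE onE] := metric_signature g p.
have lYZ : linear (fun X => metric g X Z *: Y).
  by move=> h U V; rewrite metricDl metricZl scalerDl scalerA.
rewrite (trace_atE (g := g) lYZ frE) // metricE.
rewrite [in RHS](orthonormal_expansion (value p Y) frE onE) metric_at_suml.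
apply: eq_bigr => i _.
by rewrite metricZl smooth_valM metric_atZl !metricE mulrAC mulrA.
Qed.

End TraceRules.

(** * Derivations and connections *)

Section Derivatives.
Context {R : realType} {n : nat} {M : manifold R n}.
Implicit Types (p : M) (f h : smooth_fun M) (X Y Z : vfield M).
Implicit Types (D A : vfield M -> vfield M -> vfield M).

(** A real number rather than a function: identities between vector fields
    become ring identities between real numbers. *)
Definition deriv X h p : R := (X h : smooth_fun M) p.

Lemma vfield_funext X Y : (forall h p, deriv X h p = deriv Y h p) -> X = Y.
Proof.
by move=> XY; apply: vfield_ext => p; apply: tangent_ext => h; apply: XY.
Qed.

Lemma derivDl X Y h p : deriv (X + Y) h p = deriv X h p + deriv Y h p.
Proof. exact: (smooth_valD (X h) (Y h) p). Qed.
Lemma derivNl X h p : deriv (- X) h p = - deriv X h p.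
Proof. exact: (smooth_valN (X h) p). Qed.
Lemma derivZl f X h p : deriv (f *: X) h p = f p * deriv X h p.
Proof. exact: (smooth_valM f (X h) p). Qed.

Lemma derivDr X f h p : deriv X (f + h) p = deriv X f p + deriv X h p.
Proof.
have /asboolP[Xl _] := vfield_funP X; rewrite -smooth_valD.
by rewrite -[f in LHS]scale1r /deriv Xl scale1r.
Qed.
Lemma derivMr X f h p : deriv X (f * h) p = deriv X f p * h p + f p * deriv X h p.
Proof.
have /asboolP[_ XM] := vfield_funP X.
by rewrite /deriv -!smooth_valM -smooth_valD XM.
Qed.
Lemma deriv0 X p : deriv X 0 p = 0.
Proof. by apply: (addIr (deriv X 0 p)); rewrite -derivDr !add0r. Qed.
Lemma derivNr X f p : deriv X (- f) p = - deriv X f p.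
Proof.
by apply: (addIr (deriv X f p)); rewrite -derivDr !addNr deriv0.
Qed.

Lemma derivC X (a : R) : X (a *: (1 : smooth_fun M)) = 0.
Proof.
have X1 : X 1 = 0.
  apply: smooth_funP => p; rewrite smooth_val0 -[LHS]/(deriv X 1 p).
  apply: (addrI (deriv X 1 p)); rewrite addr0 -[in RHS](mulr1 1) derivMr.
  by rewrite smooth_val1 mulr1 mul1r.
have /asboolP[Xl _] := vfield_funP X.
rewrite -[_ *: _]addr0 Xl X1 scaler0 add0r.
apply: smooth_funP => p; rewrite smooth_val0; exact: deriv0.
Qed.

Lemma deriv_lie X Y h p : deriv (lie X Y) h p = deriv X (Y h) p - deriv Y (X h) p.
Proof.
by rewrite -smooth_valN -smooth_valD.
Qed.
Lemma fold_deriv X f p : smooth_val (X f) p = deriv X f p.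
Proof. by []. Qed.

Definition vfieldE := (derivDl, derivNl, derivZl, fold_deriv, derivDr, derivNr,
  derivMr, @smooth_valD R n M, @smooth_valN R n M, @smooth_valM R n M).

End Derivatives.

(* Generalizing the atoms keeps [ring] from comparing them by conversion. *)
Ltac vfield_ring :=
  rewrite ?vfieldE;
  repeat match goal with
  | |- context [smooth_val ?f ?p] => generalize (smooth_val f p)
  | |- context [deriv ?X ?f ?p] => generalize (deriv X f p) end;
  intros; ring.

Section Connections.
Context {R : realType} {n : nat} {M : manifold R n}.
Implicit Types (p : M) (f h : smooth_fun M) (X Y Z : vfield M).
Implicit Types (D A : vfield M -> vfield M -> vfield M).

Lemma lie_linl f X X' Y :
  lie (f *: X + X') Y = f *: lie X Y + lie X' Y - (Y f : smooth_fun M) *: X.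
Proof.
apply: vfield_funext => h p; rewrite !vfieldE !deriv_lie derivDl derivZl.
have -> : deriv Y ((f *: X + X') h) p = deriv Y (f * X h + X' h) p by [].
vfield_ring.
Qed.

Section Connection.
Variables (D : vfield M -> vfield M -> vfield M).
Hypothesis connD : connection D.

Lemma connDl X X' Y : D (X + X') Y = D X Y + D X' Y.
Proof. by have [Dl _ _] := connD; rewrite -[X]scale1r Dl !scale1r. Qed.
Lemma connDr X Y Z : D X (Y + Z) = D X Y + D X Z.
Proof. by have [_ Dr _] := connD. Qed.
Lemma connZr f X Y : D X (f *: Y) = (X f : smooth_fun M) *: Y + f *: D X Y.
Proof. by have [_ _ DZ] := connD. Qed.
Lemma conn_0l Y : D 0 Y = 0.
Proof. by apply: (addIr (D 0 Y)); rewrite -connDl !add0r. Qed.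
Lemma conn_0r X : D X 0 = 0.
Proof. by apply: (addIr (D X 0)); rewrite -connDr !add0r. Qed.
Lemma connNl X Y : D (- X) Y = - D X Y.
Proof. by apply: (addIr (D X Y)); rewrite -connDl !addNr conn_0l. Qed.
Lemma connNr X Y : D X (- Y) = - D X Y.
Proof. by apply: (addIr (D X Y)); rewrite -connDr !addNr conn_0r. Qed.
Lemma connZl f X Y : D (f *: X) Y = f *: D X Y.
Proof. by have [Dl _ _] := connD; rewrite -[f *: X]addr0 Dl conn_0l addr0. Qed.

Lemma curvature_linear1 Y Z : linear (fun X => curvature D X Y Z).
Proof.
move=> f X X'; rewrite /curvature lie_linl.
rewrite !(connDl, connNl, connZl, connDr, connZr).
apply: vfield_funext => h p; vfield_ring.
Qed.

Lemma curvature_linear3 X Y : linear (curvature D X Y).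
Proof.
move=> f Z Z'; rewrite /curvature.
rewrite !(connDr, connZr).
apply: vfield_funext => h p; rewrite !vfieldE deriv_lie; vfield_ring.
Qed.

(** Since A is parallel, D X (A Y Z) = A (D X Y) Z + A Y (D X Z): the derivatives
    of Y and Z in the cross terms combine into the torsion of D. *)
Lemma curvature_parallel_shift A X Y Z :
  (forall W, linear (A^~ W)) -> (forall W, {morph A W : U V / U + V}) ->
  (forall U V W, D U (A V W) = A (D U V) W + A V (D U W)) ->
  curvature (fun X Y => D X Y + A X Y) X Y Z =
  curvature D X Y Z + A (D X Y - D Y X - lie X Y) Z + (A X (A Y Z) - A Y (A X Z)).
Proof.
move=> Al Ar DA; rewrite /curvature !connDr !Ar !DA.
have AB U V W : A (U - V) W = A U W - A V W.
  by rewrite addrC -scaleN1r Al scaleN1r addrC.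
rewrite !AB; apply: vfield_funext => h p; vfield_ring.
Qed.

End Connection.
End Connections.

(** * The one-form of a vector field and its wedge *)

Section OneForm.
Context {R : realType} {n : nat} {M : manifold R n} (g : lorentz_metric M).
Context (P : vfield M).
Implicit Types (p : M) (f : smooth_fun M) (U V W X Y Z : vfield M).
Local Notation pi := (one_form g P).

Lemma one_formD X Y : pi (X + Y) = pi X + pi Y.
Proof. exact: metricDl. Qed.
Lemma one_formN X : pi (- X) = - pi X.
Proof. exact: metricNl. Qed.
Lemma one_formZ f X : pi (f *: X) = f * pi X.
Proof. exact: metricZl. Qed.

Definition wedge X Y : vfield M := pi X *: Y - pi Y *: X.

Lemma wedge_linl W : linear (wedge^~ W).
Proof.
move=> f X Y; rewrite /wedge one_formD one_formZ.
apply: vfield_funext => h p; vfield_ring.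
Qed.

Lemma wedgeDl X Y Z : wedge (X + Y) Z = wedge X Z + wedge Y Z.
Proof.
rewrite /wedge one_formD; apply: vfield_funext => h p; vfield_ring.
Qed.

Lemma wedgeC X Y : wedge X Y = - wedge Y X.
Proof. by rewrite /wedge opprB. Qed.

Lemma wedgeDr W : {morph wedge W : X Y / X + Y}.
Proof.
move=> X Y; rewrite /wedge one_formD.
apply: vfield_funext => h p; vfield_ring.
Qed.
Lemma wedgeNl X Y : wedge (- X) Y = - wedge X Y.
Proof.
rewrite /wedge one_formN; apply: vfield_funext => h p; vfield_ring.
Qed.
Lemma wedgeZr f X Y : wedge X (f *: Y) = f *: wedge X Y.
Proof.
rewrite /wedge one_formZ; apply: vfield_funext => h p; vfield_ring.
Qed.

Lemma one_form_wedge X Y : pi (wedge X Y) = 0.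
Proof. by rewrite /wedge one_formD one_formN !one_formZ mulrC subrr. Qed.

Lemma wedge_wedge X Y Z : wedge (wedge X Y) Z = - (pi Z *: wedge X Y).
Proof. by rewrite {1}/wedge one_form_wedge scale0r sub0r. Qed.

Lemma wedge_wedge_skew X Y Z :
  wedge X (wedge Y Z) - wedge Y (wedge X Z) = - (pi Z *: wedge X Y).
Proof.
rewrite {1}/wedge [X in _ - X]/wedge !one_form_wedge !scale0r !subr0.
rewrite /wedge; apply: vfield_funext => h p; vfield_ring.
Qed.

End OneForm.

(** * Metric connections with a parallel unit field *)

Section ParallelUnit.
Context {R : realType} {n : nat} {M : manifold R n} (g : lorentz_metric M).
Variables (P : vfield M) (D : vfield M -> vfield M -> vfield M).
Implicit Types (p : M) (f : smooth_fun M) (U V W X Y Z : vfield M).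
Local Notation pi := (one_form g P).
Local Notation B := (wedge g P).

Hypothesis hP : metric g P P = -1.
Hypothesis connD : connection D.
Hypothesis D_metric : forall X Y Z,
  X (metric g Y Z) = metric g (D X Y) Z + metric g Y (D X Z).
Hypothesis DP : forall X, D X P = 0.
Hypothesis D_lie : forall X Y, lie X Y = D X Y - D Y X + B X Y.

Lemma deriv_one_form X Y : X (pi Y) = pi (D X Y).
Proof. by rewrite /one_form D_metric DP metric0r addr0. Qed.

Lemma wedge_parallel X Y Z : D X (B Y Z) = B (D X Y) Z + B Y (D X Z).
Proof.
rewrite /wedge (connDr connD) (connNr connD) !(connZr connD) !deriv_one_form.
apply: vfield_funext => h p; vfield_ring.
Qed.

Lemma torsion_wedge X Y : D X Y - D Y X - lie X Y = - B X Y.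
Proof. by rewrite D_lie opprD addrA subrr sub0r. Qed.

Lemma curvature_unit X Y : curvature D X Y P = 0.
Proof. by rewrite /curvature !DP !(conn_0r connD) !subr0. Qed.

(** Applied to pi (D X (D Y Z)) = X (Y (pi Z)), which holds because pi is
    parallel, the curvature becomes X Y - Y X - [X, Y] acting on pi Z. *)
Lemma one_form_curvature X Y Z : pi (curvature D X Y Z) = 0.
Proof.
rewrite /curvature !(one_formD, one_formN) -!deriv_one_form.
by apply: smooth_funP => p; rewrite !vfieldE deriv_lie smooth_val0; vfield_ring.
Qed.

(** The hypothesis says that [f] is locally constant, so that [f *: B] is
    parallel; [f = 1/2] cancels the torsion.  The linear term in [f] comes
    from the torsion, the quadratic one from [wedge_wedge_skew]. *)
Lemma curvature_shift_wedge f X Y Z : (forall X, X f = 0) ->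
  curvature (fun X Y => D X Y + f *: B X Y) X Y Z =
  curvature D X Y Z + ((f - f * f) * pi Z) *: B X Y.
Proof.
move=> df.
rewrite (curvature_parallel_shift (A := fun X Y => f *: B X Y) connD).
- rewrite torsion_wedge wedgeNl wedge_wedge !wedgeZr -!scalerBr wedge_wedge_skew.
  apply: vfield_funext => h p; vfield_ring.
- by move=> W h U V; rewrite wedge_linl scalerDr !scalerA [f * h]mulrC.
- by move=> W U V; rewrite wedgeDr scalerDr.
- by move=> U V W; rewrite (connZr connD) df scale0r add0r wedge_parallel scalerDr.
Qed.

(** The last two terms of [curvature4] differentiate Z along vectors whose
    difference is D Y X - B X Y - D X Y = - lie X Y, which restores the last
    term of [curvature D]. *)
Lemma curvature4_wedge X Y Z :
  curvature4 D (fun X Y => D X Y + B X Y) X Y Z =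
  curvature D X Y Z + pi Z *: B X Y.
Proof.
rewrite /curvature4 /curvature D_lie /= (wedgeC g P Y X).
rewrite (connDr connD Y (D X Z)) wedge_parallel.
rewrite (connDl connD (D X Y - D Y X)) (connDl connD (D X Y)).
rewrite (connDl connD (D Y X)) !(connNl connD).
have -> : B (D Y X - B X Y) Z = B (D Y X) Z - B (B X Y) Z.
  by rewrite wedgeDl wedgeNl.
rewrite wedge_wedge; apply: vfield_funext => h p; vfield_ring.
Qed.

(** The tensor added here is the one turning D into the torsion-free metric
    connection. *)
Lemma curvature_shift_levi_civita X Y Z :
  curvature (fun U V => D U V + (metric g U V *: P - pi V *: U)) X Y Z =
  curvature D X Y Z + (metric g Y Z *: X - metric g X Z *: Y).
Proof.
pose A U V := metric g U V *: P - pi V *: U.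
rewrite (curvature_parallel_shift (A := A) connD) {}/A.
- rewrite torsion_wedge /one_form /wedge.
  rewrite !(metricDl, metricDr, metricNl, metricNr, metricZl, metricZr).
  rewrite -!/(one_form g P _).
  rewrite (metricC g Y X) /one_form hP.
  apply: vfield_funext => h p; rewrite !vfieldE smooth_val1; vfield_ring.
- move=> W h U V; rewrite metricDl metricZl.
  by apply: vfield_funext => k p; vfield_ring.
- move=> W U V; rewrite one_formD metricDr; apply: vfield_funext => k p; vfield_ring.
- move=> U V W.
  rewrite (connDr connD) (connNr connD) !(connZr connD) DP scaler0 addr0.
  rewrite deriv_one_form D_metric.
  apply: vfield_funext => k p; vfield_ring.
Qed.

Lemma ricci_parallel_unit U p : ricci (curvature D) U P p = 0.
Proof.
have [E frE onE] := metric_signature g p.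
rewrite /ricci (trace_atE (g := g) (curvature_linear1 connD _ _) frE) //.
by rewrite big1 // => i _; rewrite curvature_unit metric0l smooth_val0 mulr0.
Qed.

Lemma trace_wedge f U p :
  trace_at p (fun X => f *: B X U) = f p * (1 - n%:R) * pi U p.
Proof.
have lw : linear (fun X => B X U) by move=> h X Y; rewrite wedge_linl.
rewrite (trace_atZ g) // -mulrA; congr (_ * _).
pose A1 X := metric g X P *: U; pose A2 X := (- pi U) *: X.
have -> : (fun X => B X U) = fun X => A1 X + A2 X.
  by apply: funext => X; rewrite /A2 scaleNr.
have l1 : linear A1.
  by move=> h X Y; rewrite /A1 metricDl metricZl scalerDl scalerA.
have l2 : linear A2.
  by move=> h X Y; rewrite /A2 scalerDr !scalerA mulrC.
rewrite (trace_atD g) // trace_at_rank1 (trace_atZ g p (- pi U) (A := id)) //.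
rewrite (trace_at_id g).
rewrite smooth_valN /one_form; ring.
Qed.

Section WedgeCurvature.
Variables (k : smooth_fun M) (Rm : vfield M -> vfield M -> vfield M -> vfield M).
Hypothesis RmE : forall X Y Z, Rm X Y Z = curvature D X Y Z + (k * pi Z) *: B X Y.

Lemma ricci_shift U V p :
  ricci Rm U V p = ricci (curvature D) U V p + k p * (1 - n%:R) * pi U p * pi V p.
Proof.
rewrite /ricci; have -> : (fun X => Rm X U V) =
    (fun X => curvature D X U V + (k * pi V) *: B X U).
  by apply: funext => X.
rewrite (trace_atD g) ?trace_wedge; first by rewrite smooth_valM; ring.
- exact: curvature_linear1.
- by move=> h X Y; rewrite wedge_linl scalerDr !scalerA [_ * h]mulrC.
Qed.

Lemma one_form_shift X Y Z : pi (Rm X Y Z) = 0.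
Proof.
by rewrite RmE one_formD one_formZ one_form_wedge mulr0 addr0 one_form_curvature.
Qed.

(** For the converse, put P in the second and third slots: Ric_k(Rm(P, Y) U, P)
    vanishes, and Rm(P, Y) P = k (Y + pi(Y) P) is orthogonal to P, so that the
    pi pi part of Ric_k drops out and k Ric1(U, Y) remains. *)
Lemma curv_ricci_shift : (forall p, k p != 0) ->
  (forall Y Z p, ricci (curvature D) Y Z p = 0) <->
  (forall U V X Y p, curv_ricci Rm U V X Y p = 0).
Proof.
move=> k0; split=> [S0 U V X Y p|RR0 U Y p].
  rewrite /curv_ricci !ricci_shift !S0 !one_form_shift smooth_val0.
  by rewrite !(mulr0, mul0r, add0r, subr0, oppr0).
have piP : pi P = -1 by [].
have := RR0 U P P Y p; rewrite /curv_ricci !ricci_shift ricci_parallel_unit.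
rewrite !one_form_shift smooth_val0.
rewrite !(mulr0, mul0r, add0r, addr0, subr0, oppr0, sub0r).
have -> : Rm P Y P = k *: (pi Y *: P + Y).
  rewrite RmE curvature_unit add0r /wedge piP; apply: vfield_funext => h q.
  by rewrite !vfieldE smooth_val1; vfield_ring.
have -> : ricci (curvature D) U (k *: (pi Y *: P + Y)) p =
    k p * ricci (curvature D) U Y p.
  rewrite /ricci -(trace_atZ g) //; last exact: curvature_linear1.
  congr trace_at; apply: funext => X.
  have L3 := curvature_linear3 connD X U.
  have L0 : curvature D X U 0 = 0.
    by have := L3 (-1) 0 0; rewrite scaler0 addr0 scaleN1r addNr.
  by rewrite -[k *: (_ + _)]addr0 !L3 L0 curvature_unit scaler0 add0r addr0.
by move=> /eqP; rewrite oppr_eq0 mulf_eq0 (negPf (k0 p)) /= => /eqP.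
Qed.

End WedgeCurvature.

End ParallelUnit.

(** * The semi-symmetric metric connection and the theorem *)

Section GRW.
Context {R : realType} {n : nat} {M : manifold R n} (g : lorentz_metric M).
Variables (Dg : vfield M -> vfield M -> vfield M) (P : vfield M).
Hypotheses (lcD : levi_civita g Dg) (hP : metric g P P = -1).
Hypothesis D1P : forall X : vfield M, conn1 g Dg P X P = 0.
Implicit Types (p : M) (f : smooth_fun M) (U V W X Y Z : vfield M).
Local Notation pi := (one_form g P).
Local Notation D1 := (conn1 g Dg P).

Lemma connection_conn1 : connection D1.
Proof.
have [connDg _ _] := lcD; split=> [f X Y Z|X Y Z|f X Y]; rewrite /conn1.
- rewrite (connDl connDg) (connZl connDg) metricDl metricZl.
  apply: vfield_funext => h p; vfield_ring.
- rewrite (connDr connDg) one_formD metricDr.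
  apply: vfield_funext => h p; vfield_ring.
- rewrite (connZr connDg) one_formZ metricZr.
  apply: vfield_funext => h p; vfield_ring.
Qed.

Lemma conn1_metric X Y Z :
  X (metric g Y Z) = metric g (D1 X Y) Z + metric g Y (D1 X Z).
Proof.
have [_ _ ->] := lcD; rewrite /conn1 /one_form.
rewrite !(metricDl, metricDr, metricNl, metricNr, metricZl, metricZr).
rewrite (metricC g Y X) (metricC g P Z).
apply: smooth_funP => p; vfield_ring.
Qed.

Lemma lie_conn1 X Y : lie X Y = D1 X Y - D1 Y X + wedge g P X Y.
Proof.
have [_ <- _] := lcD; rewrite /conn1 /wedge (metricC g Y X).
apply: vfield_funext => h p; vfield_ring.
Qed.

Lemma conn2E : conn2 g Dg P = fun X Y => D1 X Y + wedge g P X Y.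
Proof.
apply: funext => X; apply: funext => Y; rewrite /conn2 lie_conn1.
apply: vfield_funext => h p; vfield_ring.
Qed.

Definition half : smooth_fun M := (2^-1 : R) *: (1 : smooth_fun M).

Lemma halfE p : half p = 2^-1.
Proof. by rewrite smooth_valZ smooth_val1 mulr1. Qed.

Lemma deriv_half X : X half = 0.
Proof. exact: derivC. Qed.

Lemma conn0E : conn0 g Dg P = fun X Y => D1 X Y + half *: wedge g P X Y.
Proof.
apply: funext => X; apply: funext => Y; rewrite /conn0 -/half conn2E.
by apply: vfield_funext => h p; rewrite !vfieldE halfE; field.
Qed.

(** Ric1 = Ric - (n - 1) g, and Ric1(P, P) = 0 pins down the Einstein constant. *)
Lemma einstein_ricci1 :
  einstein g Dg <-> forall Y Z p, ricci (curvature D1) Y Z p = 0.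
Proof.
have R1E Y Z p : ricci (curvature Dg) Y Z p =
    ricci (curvature D1) Y Z p + (n%:R - 1) * metric g Y Z p.
  pose A1 X := metric g Y Z *: X; pose A2 X := metric g X Z *: (- Y).
  have l1 : linear A1.
    by move=> h U V; rewrite /A1 scalerDr !scalerA mulrC.
  have l2 : linear A2.
    by move=> h U V; rewrite /A2 metricDl metricZl scalerDl scalerA.
  rewrite /ricci; have -> : (fun X => curvature Dg X Y Z) =
      (fun X => curvature D1 X Y Z + (A1 X + A2 X)).
    apply: funext => X; rewrite /A2 scalerN.
    have DgE : Dg = fun U V => D1 U V + (metric g U V *: P - pi V *: U).
      apply: funext => U; apply: funext => V; rewrite /conn1.
      apply: vfield_funext => h q; vfield_ring.
    rewrite {1}DgE curvature_shift_levi_civita //; first exact: connection_conn1.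
      exact: conn1_metric.
    exact: lie_conn1.
  have l12 : linear (fun X => A1 X + A2 X).
    by move=> h U V; rewrite l1 l2 scalerDr addrACA.
  have lR : linear (fun X => curvature D1 X Y Z).
    exact: (curvature_linear1 connection_conn1).
  rewrite (trace_atD g p lR l12) (trace_atD g p l1 l2) (trace_at_rank1 g p (- Y) Z).
  rewrite (trace_atZ g p (metric g Y Z) (A := id)) // (trace_at_id g).
  by rewrite metricNl smooth_valN; ring.
split=> [[l Eg] Y Z p|S0]; last first.
  by exists (n%:R - 1) => Y Z p; rewrite R1E S0 add0r.
have := Eg P P p; rewrite R1E (ricci_parallel_unit g connection_conn1 D1P) hP.
rewrite smooth_valN smooth_val1 add0r !mulrN1 => /oppr_inj lE.
by apply: (addIr ((n%:R - 1) * metric g Y Z p)); rewrite -R1E Eg -lE add0r.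
Qed.

End GRW.

Theorem theorem4p8 (R : realType) (n : nat) (hn : (3 <= n)%N)
    (M : manifold R n)
    (g : lorentz_metric M)
    (Dg : vfield M -> vfield M -> vfield M) (hDg : levi_civita g Dg)
    (P : vfield M) (hP : metric g P P = -1)
    (hD1P : forall X : vfield M, conn1 g Dg P X P = 0) :
  let D1 := conn1 g Dg P in
  let D2 := conn2 g Dg P in
  let D0 := conn0 g Dg P in
  let R0 := curvature D0 in
  let R4 := curvature4 D1 D2 in
  (einstein g Dg <->
     forall (U V X Y : vfield M) (p : M), curv_ricci R0 U V X Y p = 0) /\
  (einstein g Dg <->
     forall (U V X Y : vfield M) (p : M), curv_ricci R4 U V X Y p = 0).
Proof.
move=> D1 D2 D0 R0 R4.
have connD1 := connection_conn1 P hDg.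
have D1_metric := conn1_metric P hDg.
have D1_lie := lie_conn1 P hDg.
have R0E X Y Z : R0 X Y Z = curvature D1 X Y Z +
    ((half - half * half) * one_form g P Z) *: wedge g P X Y.
  rewrite /R0 /D0 conn0E //; apply: curvature_shift_wedge => // W.
  exact: deriv_half.
have R4E X Y Z : R4 X Y Z = curvature D1 X Y Z +
    (1 * one_form g P Z) *: wedge g P X Y.
  by rewrite mul1r /R4 /D2 conn2E //; apply: curvature4_wedge.
have [E01 E10] := einstein_ricci1 hDg hP hD1P.
split; apply: (iff_trans (conj E01 E10)).
  apply: (curv_ricci_shift hP connD1 D1_metric hD1P R0E) => p.
  rewrite smooth_valD smooth_valN smooth_valM halfE.
  have -> : (2^-1 - 2^-1 * 2^-1 : R) = 4^-1 by field.
  by rewrite invr_eq0 pnatr_eq0.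
apply: (curv_ricci_shift hP connD1 D1_metric hD1P R4E) => p.
by rewrite smooth_val1 oner_eq0.
Qed.
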